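(* Let $\mathcal{M}$ be a finite unitary magma and $\mathcal{A}$ be an $\mathcal{M}$-compatible associative algebra, with associative product $\odot$ and linear maps $\omega_x:\mathcal{A}\to\mathcal{A}$, $x\in\mathcal{M}$. The vector space $\mathcal{A}$ endowed with the binary linear operations $\mathfrak{p}:\mathcal{A}\otimes\mathcal{A}\to\mathcal{A}$, indexed by the $\mathcal{M}$-triangles $\mathfrak{p}\in\mathcal{T}_{\mathcal{M}}$ and defined for any $a_1,a_2\in\mathcal{A}$ by $$\mathfrak{p}(a_1,a_2):=\omega_{\mathfrak{p}_0}\big(\omega_{\mathfrak{p}_1}(a_1)\odot\omega_{\mathfrak{p}_2}(a_2)\big),$$ is an $\mathsf{NC}\mathcal{M}$-algebra (the operation displayed being the action of the generator $\mathfrak{p}\in\mathcal{T}_{\mathcal{M}}$ of $\mathsf{NC}\mathcal{M}$).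
   Context: All vector spaces are over a field $\mathbb{K}$ of characteristic zero; $[n]=\{1,\dots,n\}$. A unitary magma is a set $\mathcal{M}$ with a binary operation $\star$ (not necessarily associative) having a two-sided unit $\mathds{1}_{\mathcal{M}}$. An associative algebra $(\mathcal{A},\odot)$ together with a family of linear maps $\omega_x:\mathcal{A}\to\mathcal{A}$, $x\in\mathcal{M}$ (not necessarily algebra morphisms), is $\mathcal{M}$-compatible if $\omega_{\mathds{1}_{\mathcal{M}}}=\mathrm{Id}_{\mathcal{A}}$ and $\omega_x\circ\omega_y=\omega_{x\star y}$ for all $x,y\in\mathcal{M}$. An $\mathcal{M}$-clique $\mathfrak{p}$ of arity $n\ge1$ is a map assigning to every arc $(x,y)$, $1\le x<y\le n+1$, a label $\mathfrak{p}(x,y)\in\mathcal{M}$; by convention, the only $\mathcal{M}$-clique of arity $1$ is the one with $\mathfrak{p}(1,2)=\mathds{1}_{\mathcal{M}}$. Put $\mathfrak{p}_0:=\mathfrak{p}(1,n+1)$ and $\mathfrak{p}_i:=\mathfrak{p}(i,i+1)$ for $i\in[n]$. For $\mathcal{M}$-cliques $\mathfrak{p},\mathfrak{q}$ of arities $n,m$ and $i\in[n]$, $\mathfrak{p}\circ_i\mathfrak{q}$ is the $\mathcal{M}$-clique of arity $n+m-1$ with $$(\mathfrak{p}\circ_i\mathfrak{q})(x,y)=\begin{cases}\mathfrak{p}(x,y)&\text{if }y\le i,\\ \mathfrak{p}(x,y-m+1)&\text{if }x\le i<i+m\le y,\ (x,y)\ne(i,i+m),\\ \mathfrak{p}(x-m+1,y-m+1)&\text{if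 }i+m\le x,\\ \mathfrak{q}(x-i+1,y-i+1)&\text{if }i\le x<y\le i+m,\ (x,y)\ne(i,i+m),\\ \mathfrak{p}_i\star\mathfrak{q}_0&\text{if }(x,y)=(i,i+m),\\ \mathds{1}_{\mathcal{M}}&\text{otherwise.}\end{cases}$$ A diagonal is an arc different from $(1,n+1)$ and from all $(x,x+1)$; an arc is solid if its label is not $\mathds{1}_{\mathcal{M}}$; diagonals $(x,y)$, $(x',y')$ are crossing if $x<x'<y<y'$ or $x'<x<y'<y$. An $\mathcal{M}$-clique is noncrossing if no two of its solid diagonals are crossing. $\mathsf{NC}\mathcal{M}$ is the (nonsymmetric) operad spanned by all noncrossing $\mathcal{M}$-cliques, with the partial compositions $(\mathfrak{p},\mathfrak{q})\mapsto\mathfrak{p}\circ_i\mathfrak{q}$ of $\mathcal{M}$-cliques extended bilinearly and with the unique $\mathcal{M}$-clique of arity $1$ as unit. $\mathcal{T}_{\mathcal{M}}$ is the set of $\mathcal{M}$-triangles, i.e. $\mathcal{M}$-cliques of arity $2$; it generates $\mathsf{NC}\mathcal{M}$. For an operad $\mathcal{O}$, an $\mathcal{O}$-algebra is a vector space $\mathcal{A}$ with linear maps $\cdot:\mathcal{O}(n)\otimes\mathcal{A}^{\otimes n}\to\mathcal{A}$, $n\ge1$, with the unit acting as the identity and $(x\circ_iy)\cdot(a_1\otimes\cdots\otimes a_{n+m-1})=x\cdot(a_1\otimes\cdots\otimes a_{i-1}\otimes y\cdot(a_i\otimes\cdots\otimes a_{i+m-1})\otimes a_{i+m}\otimes\cdots\otimes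 a_{n+m-1})$ for $x\in\mathcal{O}(n)$, $y\in\mathcal{O}(m)$, $i\in[n]$. It is determined by the actions of a generating set of $\mathcal{O}$; giving operations for the elements of $\mathcal{T}_{\mathcal{M}}$ defines an $\mathsf{NC}\mathcal{M}$-algebra when they extend to such an action of $\mathsf{NC}\mathcal{M}$. *)

(* Defs.v *)
From HB Require Import structures.
From mathcomp Require Import all_boot all_algebra.
From mathcomp Require Import zify.

Set Implicit Arguments.
Unset Strict Implicit.
Unset Printing Implicit Defensive.

Import GRing.Theory.
Local Open Scope ring_scope.

(* The library's [umagmaType] has no join with [finType]. *)
Record finUMagma := FinUMagma {
  umagma_sort :> finType;
  star : umagma_sort -> umagma_sort -> umagma_sort;
  one : umagma_sort;
  star1m : left_id one star;
  starm1 : right_id one star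
}.

Arguments star {M} x y : rename.
Arguments one {M} : rename.

(* Inputs of operations are numbered from 0, so [pcomp x i y] plugs [y] into
   the input of [x] that is the (i+1)-st one in 1-based numbering.  An operad
   is graded by the arities n >= 1: its component of arity 0 is zero.  The
   casts in the axioms are along equalities of arities that always hold. *)
Record ns_operad (K : fieldType) := NsOperad {
  component :> nat -> lmodType K;
  pcomp : forall n m, 'I_n -> component n -> component m ->
    component (n + m).-1;
  opunit : component 1;
  component0 : forall x : component 0, x = 0;
  pcomp_linearl : forall n m (i : 'I_n) (y : component m),
    linear (fun x => pcomp i x y);
  pcomp_linearr : forall n m (i : 'I_n) (x : component n),
    linear (fun y : component m => pcomp i x y);
  pcomp_unitl : forall n (x : component n),
    pcomp ord0 opunit x = x :> component n;
  pcomp_unitr : forall n (i : 'I_n) (x : component n)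
    (e : (n + 1).-1 = n),
    ecast k (component k) e (pcomp i x opunit) = x;
  pcomp_seq : forall n m l (i : 'I_n) (j : 'I_m) (k : 'I_(n + m).-1)
    (x : component n) (y : component m) (z : component l)
    (e : ((n + m).-1 + l).-1 = (n + (m + l).-1).-1),
    k = (i + j)%N :> nat ->
    ecast a (component a) e (pcomp k (pcomp i x y) z) =
      pcomp i x (pcomp j y z);
  pcomp_par : forall n m l (i j : 'I_n) (k : 'I_(n + m).-1)
    (i' : 'I_(n + l).-1)
    (x : component n) (y : component m) (z : component l)
    (e : ((n + m).-1 + l).-1 = ((n + l).-1 + m).-1),
    (i < j)%N -> k = (j + m).-1 :> nat -> i' = i :> nat ->
    ecast a (component a) e (pcomp k (pcomp i x y) z) =
      pcomp i' (pcomp j x z) y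
}.

Arguments pcomp {K O n m} i x y : rename.
Arguments opunit {K O} : rename.

Section OperadAlgebra.

Variables (K : fieldType) (A : lmodType K).

Definition set_input n (a : n.-tuple A) (i : 'I_n) (v : A) : n.-tuple A :=
  [tuple if j == i then v else tnth a j | j < n].

Definition block n m (i : 'I_n) (a : (n + m).-1.-tuple A) : m.-tuple A :=
  [tuple nth 0 a (i + k)%N | k < m].

Definition contract n m (i : 'I_n) (v : A) (a : (n + m).-1.-tuple A) :
    n.-tuple A :=
  [tuple if (j < i)%N then nth 0 a j
         else if (i < j)%N then nth 0 a (j + m).-1 else v | j < n].

(* A linear map O(n) (x) A^(x)n -> A is given by the corresponding map that is
   linear in the operation and in each of the n inputs. *)
Record is_operad_algebra (O : ns_operad K)
    (act : forall n, O n -> n.-tuple A -> A) : Prop := IsOperadAlgebra {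
  act_linear : forall n (a : n.-tuple A), linear (fun x : O n => act n x a);
  act_multilinear : forall n (x : O n) (a : n.-tuple A) (i : 'I_n),
    linear (fun v => act n x (set_input a i v));
  act_unit : forall a : A, act 1%N opunit [tuple a] = a;
  act_pcomp : forall n m (i : 'I_n) (x : O n) (y : O m)
    (a : (n + m).-1.-tuple A),
    act (n + m).-1 (pcomp i x y) a =
      act n x (contract i (act m y (block i a)) a)
}.

End OperadAlgebra.

Section Cliques.

Variable M : finUMagma.

(* The vertices of a clique of arity n are 0, ..., n instead of 1, ..., n+1. *)
Definition arc n := {a : 'I_n.+1 * 'I_n.+1 | (a.1 < a.2)%N}.

Definition src n (a : arc n) : nat := (val a).1.
Definition tgt n (a : arc n) : nat := (val a).2.

Definition labelling n := {ffun arc n -> M}.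

(* [label p x y] is the label of the arc (x, y) if x < y <= n, and the unit of
   M otherwise; only the former values matter. *)
Definition label n (p : labelling n) (x y : nat) : M :=
  oapp p one [pick a : arc n | (src a == x) && (tgt a == y)].

(* In 1-based numbering, [base p] is p_0 and [edge p i] is p_(i+1). *)
Definition base n (p : labelling n) : M := label p 0 n.
Definition edge n (p : labelling n) (i : nat) : M := label p i i.+1.

Definition is_clique n (p : labelling n) : bool :=
  (0 < n)%N && ((n == 1%N) ==> [forall a, p a == one]).

Definition clique n := {p : labelling n | is_clique p}.

Definition is_diagonal n (a : arc n) : bool :=
  ((src a, tgt a) != (0%N, n)) && (tgt a != (src a).+1).

Definition crossing n (a b : arc n) : bool :=
  [&& src a < src b, src b < tgt a & tgt a < tgt b]%N ||
  [&& src b < src a, src a < tgt b & tgt b < tgt a]%N.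

Definition solid n (p : labelling n) (a : arc n) : bool := p a != one.

Definition is_noncrossing n (p : labelling n) : bool :=
  [forall a, forall b,
     [&& is_diagonal a, solid p a, is_diagonal b & solid p b] ==>
     ~~ crossing a b].

Definition nc_clique n := {p : clique n | is_noncrossing (val p)}.

(* Shifting i, x and y by one leaves x - m + 1 and y - m + 1 unchanged in the
   usual 1-based formula, and turns x - i + 1 and y - i + 1 into x - i and
   y - i. *)
Definition comp_label n m (i : nat) (p : labelling n) (q : labelling m)
    (x y : nat) : M :=
  if (x == i) && (y == i + m)%N then star (edge p i) (base q)
  else if (y <= i)%N then label p x y
  else if (x <= i)%N && (i + m <= y)%N then label p x (y - m + 1)%N
  else if (i + m <= x)%N then label p (x - m + 1)%N (y - m + 1)%N
  else if (i <= x)%N && (y <= i + m)%N then label q (x - i)%N (y - i)%N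
  else one.

Definition comp_labelling n m (i : 'I_n) (p : labelling n) (q : labelling m) :
    labelling (n + m).-1 :=
  [ffun a => comp_label i p q (src a) (tgt a)].

Lemma label_arc n (p : labelling n) (a : arc n) : label p (src a) (tgt a) = p a.
Proof.
rewrite /label; case: pickP => [b /andP[/eqP h1 /eqP h2]|/(_ a)] /=.
  congr (p _); apply/val_inj; case: b a h1 h2 => [[b1 b2] hb] [[a1 a2] ha].
  rewrite /src /tgt /= => h1 h2.
  by congr pair; apply: ord_inj.
by rewrite !eqxx.
Qed.

Lemma arc_ex n x y : (x < y)%N -> (y <= n)%N ->
  exists a : arc n, src a = x /\ tgt a = y.
Proof.
move=> xy yn; have xn : (x < n.+1)%N by lia.
by exists (Sub (Ordinal xn, Ordinal (yn : (y < n.+1)%N)) xy).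
Qed.

Lemma arc_lt n (a : arc n) : (src a < tgt a)%N.
Proof. by case: a. Qed.

Lemma arc_le n (a : arc n) : (tgt a <= n)%N.
Proof. by rewrite /tgt -ltnS ltn_ord. Qed.

Lemma label_ext n (p q : labelling n) :
  (forall x y, (x < y)%N -> (y <= n)%N -> label p x y = label q x y) -> p = q.
Proof.
move=> h; apply/ffunP => a; rewrite -!label_arc.
by apply: h; [apply: arc_lt | apply: arc_le].
Qed.

Lemma label_ffun n (F : nat -> nat -> M) x y : (x < y)%N -> (y <= n)%N ->
  label ([ffun a => F (src a) (tgt a)] : labelling n) x y = F x y.
Proof. by move=> xy yn; have [a [<- <-]] := arc_ex xy yn; rewrite label_arc ffunE. Qed.

Lemma label_comp n m (i : 'I_n) p (q : labelling m) x y :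
  (x < y)%N -> (y <= (n + m).-1)%N ->
  label (comp_labelling i p q) x y = comp_label i p q x y.
Proof. exact: label_ffun. Qed.

Lemma clique_gt0 n (p : clique n) : (0 < n)%N.
Proof. by case: p => p /= /andP[]. Qed.

Lemma clique1P n (p : labelling n) :
  reflect ((0 < n)%N /\ (n = 1%N -> label p 0 1 = one)) (is_clique p).
Proof.
apply: (iffP andP) => -[n0 h]; split=> //.
  move=> n1; have /forallP {}h := implyP h (introT eqP n1).
  have [a [<- <-]] := @arc_ex n 0 1 isT n0.
  by rewrite label_arc; apply/eqP/h.
apply/implyP => /eqP n1; apply/forallP => a; rewrite -label_arc.
have h1 := arc_lt a; have h2 := arc_le a.
have -> : src a = 0%N by lia.
have -> : tgt a = 1%N by lia.
by rewrite h.
Qed.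

Lemma label_clique1 n (p : clique n) : n = 1%N -> label (val p) 0 1 = one.
Proof. by case: (clique1P _ (valP p)). Qed.

Lemma comp_clique_subproof n m (i : 'I_n) (p : clique n) (q : clique m) :
  is_clique (comp_labelling i (val p) (val q)).
Proof.
have n0 := clique_gt0 p; have m0 := clique_gt0 q.
apply/clique1P; split; first by lia.
move=> h; have n1 : n = 1%N by lia.
have m1 : m = 1%N by lia.
have i0 : i = 0%N :> nat by have := ltn_ord i; lia.
rewrite label_comp //; last by lia.
rewrite /comp_label /edge /base; case: ifP => [_|]; last by lia.
by rewrite i0 (label_clique1 p n1) star1m [X in label _ _ X]m1 (label_clique1 q m1).
Qed.

Definition comp_clique n m (i : 'I_n) (p : clique n) (q : clique m) :
    clique (n + m).-1 :=
  Sub (comp_labelling i (val p) (val q)) (comp_clique_subproof i p q).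

Lemma unit_clique_subproof : is_clique ([ffun=> one] : labelling 1).
Proof. by apply/andP; split=> //; apply/implyP => _; apply/forallP => a; rewrite ffunE. Qed.

Definition unit_clique : clique 1 := Sub [ffun=> one] unit_clique_subproof.

Lemma noncrossingP n (p : labelling n) :
  reflect (forall x x' y y', (x < x')%N -> (x' < y)%N -> (y < y')%N ->
     (y' <= n)%N -> label p x y = one \/ label p x' y' = one)
  (is_noncrossing p).
Proof.
apply: (iffP forallP) => h.
  move=> x x' y y' h1 h2 h3 h4.
  have [||a [ax ay]] := @arc_ex n x y; [by lia | by lia |].
  have [||b [bx by']] := @arc_ex n x' y'; [by lia | by lia |].
  have /forallP/(_ b)/implyP := h a.
  rewrite /is_diagonal /crossing /solid -!label_arc ax ay bx by'.
  rewrite !xpair_eqE.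
  case: (label p x y =P one) => [|_]; first by left.
  case: (label p x' y' =P one) => [|_]; first by right.
  by lia.
move=> a; apply/forallP => b; apply/implyP => /and4P[_ sa _ sb].
move: sa sb; rewrite /solid -!label_arc /crossing => /eqP sa /eqP sb.
have := arc_le a; have := arc_le b => lb la.
apply/negP => /orP[/and3P[h1 h2 h3]|/and3P[h1 h2 h3]].
  by case: (h _ _ _ _ h1 h2 h3 lb).
by case: (h _ _ _ _ h1 h2 h3 la).
Qed.

Lemma comp_nc_subproof n m (i : 'I_n) (p : nc_clique n) (q : nc_clique m) :
  is_noncrossing (val (comp_clique i (val p) (val q))).
Proof.
have n0 := clique_gt0 (val p); have m0 := clique_gt0 (val q).
have iN := ltn_ord i.
have /noncrossingP hp := valP p; have /noncrossingP hq := valP q.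
apply/noncrossingP => x x' y y' h1 h2 h3 h4.
rewrite SubK !label_comp; try lia.
rewrite /comp_label.
repeat (case: ifP => ?); try (by lia); try (by left); try (by right);
  by [apply: hp; lia | apply: hq; lia].
Qed.

Definition comp_nc n m (i : 'I_n) (p : nc_clique n) (q : nc_clique m) :
    nc_clique (n + m).-1 :=
  Sub (comp_clique i (val p) (val q)) (comp_nc_subproof i p q).

Lemma unit_nc_subproof : is_noncrossing (val unit_clique).
Proof. by apply/noncrossingP => x x' y y'; lia. Qed.

Definition unit_nc : nc_clique 1 := Sub unit_clique unit_nc_subproof.

Lemma triangle_nc_subproof (p : clique 2) : is_noncrossing (val p).
Proof. by apply/noncrossingP => x x' y y'; lia. Qed.

Definition triangle_nc (p : clique 2) : nc_clique 2 :=
  Sub p (triangle_nc_subproof p).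

Lemma label_out n (p : labelling n) x y :
  ~~ (x < y <= n)%N -> label p x y = one.
Proof.
move=> h; rewrite /label; case: pickP => //= a /andP[/eqP ax /eqP ay].
by case/negP: h; rewrite -ax -ay arc_lt arc_le.
Qed.

Definition nclabel n (p : nc_clique n) := label (val (val p)).

Lemma nc_ext n (p q : nc_clique n) :
  (forall x y, (x < y)%N -> (y <= n)%N -> nclabel p x y = nclabel q x y) ->
  p = q.
Proof. by move=> h; do 2!apply: val_inj; apply: label_ext. Qed.

Lemma nclabel_cast n m (e : n = m) (p : nc_clique n) x y :
  nclabel (ecast k (nc_clique k) e p) x y = nclabel p x y.
Proof. by case: m / e. Qed.

Lemma nclabel_comp n m (i : 'I_n) (p : nc_clique n) (q : nc_clique m) x y :
  (x < y)%N -> (y <= (n + m).-1)%N ->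
  nclabel (comp_nc i p q) x y =
    if (x == i) && (y == i + m)%N then star (nclabel p i i.+1) (nclabel q 0 m)
    else if (y <= i)%N then nclabel p x y
    else if (x <= i)%N && (i + m <= y)%N then nclabel p x (y - m + 1)%N
    else if (i + m <= x)%N then nclabel p (x - m + 1)%N (y - m + 1)%N
    else if (i <= x)%N && (y <= i + m)%N then nclabel q (x - i)%N (y - i)%N
    else one.
Proof. exact: label_comp. Qed.

Lemma nclabel1 n (p : nc_clique n) x y :
  n = 1%N -> x = 0%N -> y = 1%N -> nclabel p x y = one.
Proof. by move=> n1 -> ->; apply: label_clique1. Qed.

Lemma nc_gt0 n (p : nc_clique n) : (0 < n)%N.
Proof. exact: clique_gt0 (val p). Qed.

Lemma comp_nc_unitl n (p : nc_clique n) :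
  comp_nc ord0 unit_nc p = p :> nc_clique n.
Proof.
have n0 := nc_gt0 p.
apply: nc_ext => x y xy yn.
apply: etrans (@nclabel_comp 1 n ord0 unit_nc p x y xy yn) _ => /=.
case: ifP => [h|h].
  rewrite nclabel1 // star1m; congr nclabel; lia.
by repeat (case: ifP => ?); try (by lia); congr nclabel; lia.
Qed.

Lemma comp_nc_unitr n (i : 'I_n) (p : nc_clique n) (e : (n + 1).-1 = n) :
  ecast k (nc_clique k) e (comp_nc i p unit_nc) = p.
Proof.
have iN := ltn_ord i.
apply: nc_ext => x y xy yn; rewrite nclabel_cast nclabel_comp //; last by lia.
case: ifP => [h|h].
  rewrite (nclabel1 unit_nc) // starm1; congr nclabel; lia.
by repeat (case: ifP => ?); try (by lia); congr nclabel; lia.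
Qed.

Variant comp_spec n m i (p : nc_clique n) (q : nc_clique m) x y : M -> Prop :=
| CompNew of x = i & y = (i + m)%N :
    comp_spec i p q x y (star (nclabel p i i.+1) (nclabel q 0 m))
| CompLeft of (y <= i)%N : comp_spec i p q x y (nclabel p x y)
| CompOver of (x <= i)%N & (i + m <= y)%N & (x < i)%N || (i + m < y)%N :
    comp_spec i p q x y (nclabel p x (y - m + 1)%N)
| CompRight of (i + m <= x)%N :
    comp_spec i p q x y (nclabel p (x - m + 1)%N (y - m + 1)%N)
| CompIn of (i <= x)%N & (y <= i + m)%N & (i < x)%N || (y < i + m)%N :
    comp_spec i p q x y (nclabel q (x - i)%N (y - i)%N)
| CompCross of (x < i)%N && (i < y)%N && (y < i + m)%N ||
               ((i < x)%N && (x < i + m)%N && (i + m < y)%N) :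
    comp_spec i p q x y one.

Lemma nclabel_compP n m (i : 'I_n) (p : nc_clique n) (q : nc_clique m) x y :
  comp_spec i p q x y (nclabel (comp_nc i p q) x y).
Proof.
have iN := ltn_ord i; have m0 := nc_gt0 q.
have [/andP[xy yn]|xyn] := boolP ((x < y) && (y <= (n + m).-1))%N; last first.
  rewrite /nclabel label_out //.
  have [yi|yi] := leqP y i.
    by rewrite -(@label_out _ (val (val p)) x y); [apply: CompLeft|lia].
  have [xy|xy] := ltnP x y.
    have [xi|xi] := leqP x i.
      rewrite -(@label_out _ (val (val p)) x (y - m + 1)); last by lia.
      by apply: CompOver; lia.
    rewrite -(@label_out _ (val (val p)) (x - m + 1) (y - m + 1)); last by lia.
    have [?|?] := leqP (i + m) x; first exact: CompRight.
    by rewrite label_out; [apply: CompCross|]; lia.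
  have [?|?] := leqP (i + m) x.
    by rewrite -(@label_out _ (val (val p)) (x - m + 1) (y - m + 1)); [apply: CompRight|lia].
  rewrite -(@label_out _ (val (val q)) (x - i) (y - i)); last by lia.
  by apply: CompIn; lia.
rewrite nclabel_comp //.
case: ifP => [/andP[/eqP ? /eqP ?]|?]; first exact: CompNew.
case: ifP => ?; first exact: CompLeft.
case: ifP => [/andP[? ?]|?]; first by apply: CompOver => //; lia.
case: ifP => ?; first exact: CompRight.
case: ifP => [/andP[? ?]|?]; first by apply: CompIn => //; lia.
by apply: CompCross; lia.
Qed.

Ltac comp_case := match goal with
  |- context [nclabel (@comp_nc ?n ?m ?i ?p ?q) ?x ?y] =>
    destruct (@nclabel_compP n m i p q x y); try (exfalso; lia)
  end.

Lemma comp_nc_seq n m l (i : 'I_n) (j : 'I_m) (k : 'I_(n + m).-1)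
    (p : nc_clique n) (q : nc_clique m) (r : nc_clique l)
    (e : ((n + m).-1 + l).-1 = (n + (m + l).-1).-1) :
  k = (i + j)%N :> nat ->
  ecast a (nc_clique a) e (comp_nc k (comp_nc i p q) r) =
    comp_nc i p (comp_nc j q r).
Proof.
move=> kE; have iN := ltn_ord i; have jN := ltn_ord j.
have n0 := nc_gt0 p; have m0 := nc_gt0 q; have l0 := nc_gt0 r.
apply: nc_ext => x y xy yn; rewrite nclabel_cast; clear e yn.
do 4?comp_case; try (by []); try (by congr nclabel; lia).
- rewrite (@nclabel1 _ q 0 m) ?starm1 ?(@nclabel1 _ q j j.+1) ?star1m //; lia.
- by congr star; congr nclabel; lia.
- by congr star; congr nclabel; lia.
Qed.

Lemma comp_nc_par n m l (i j : 'I_n) (k : 'I_(n + m).-1)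
    (i' : 'I_(n + l).-1)
    (p : nc_clique n) (q : nc_clique m) (r : nc_clique l)
    (e : ((n + m).-1 + l).-1 = ((n + l).-1 + m).-1) :
  (i < j)%N -> k = (j + m).-1 :> nat -> i' = i :> nat ->
  ecast a (nc_clique a) e (comp_nc k (comp_nc i p q) r) =
    comp_nc i' (comp_nc j p r) q.
Proof.
move=> ij kE iE; have jN := ltn_ord j.
have n0 := nc_gt0 p; have m0 := nc_gt0 q; have l0 := nc_gt0 r.
apply: nc_ext => x y xy yn; rewrite nclabel_cast; clear e yn.
do 4?comp_case; try (by []); try (by congr nclabel; lia);
  by congr star; congr nclabel; lia.
Qed.

End Cliques.

Section FreeModule.

Variable K : fieldType.

(* The K-vector space with basis T; K^o is K as a module over itself. *)
Definition free_mod (T : finType) : lmodType K := {ffun T -> K^o}.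

Definition delta (T : finType) (t : T) : free_mod T := [ffun u => (u == t)%:R].

Definition bilinear_ext (S T U : finType) (h : S -> T -> U)
    (f : free_mod S) (g : free_mod T) : free_mod U :=
  \sum_s \sum_t (f s * g t) *: delta (h s t).

Lemma free_modD (T : finType) (f g : free_mod T) t : (f + g) t = f t + g t.
Proof. by rewrite ffunE. Qed.

Lemma free_modZ (T : finType) a (f : free_mod T) t : (a *: f) t = a * f t.
Proof. by rewrite ffunE. Qed.

Lemma deltaE (T : finType) (t u : T) : delta t u = (u == t)%:R.
Proof. by rewrite ffunE. Qed.

Lemma free_mod_sum (T : finType) (f : free_mod T) :
  f = \sum_t f t *: delta t.
Proof.
apply/ffunP => r; rewrite sum_ffunE (bigD1 r) //= big1 => [|p pr].
  by rewrite free_modZ deltaE eqxx mulr1 addr0.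
by rewrite free_modZ deltaE eq_sym (negbTE pr) mulr0.
Qed.

Lemma linear_ext (T : finType) (V : lmodType K) (f g : free_mod T -> V) :
  linear f -> linear g -> (forall t, f (delta t) = g (delta t)) -> f =1 g.
Proof.
move=> hf hg h x.
pose F := HB.pack_for {linear free_mod T -> V} f
  (GRing.isLinear.Build _ _ _ _ f hf).
pose G := HB.pack_for {linear free_mod T -> V} g
  (GRing.isLinear.Build _ _ _ _ g hg).
rewrite -[f x]/(F x) -[g x]/(G x) (free_mod_sum x) !linear_sum.
by apply: eq_bigr => t _; rewrite !linearZ /= h.
Qed.

Lemma linear_comp (U V W : lmodType K) (g : V -> W) (f : U -> V) :
  linear g -> linear f -> linear (fun x => g (f x)).
Proof. by move=> hg hf a u v; rewrite hf hg. Qed.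

Lemma bilinear_extl (S T U : finType) (h : S -> T -> U) (g : free_mod T) :
  linear (fun f => bilinear_ext h f g).
Proof.
move=> a u v; rewrite /bilinear_ext scaler_sumr -big_split /=.
apply: eq_bigr => s _; rewrite scaler_sumr -big_split /=.
by apply: eq_bigr => t _; rewrite free_modD free_modZ scalerA -scalerDl mulrDl mulrA.
Qed.

Lemma bilinear_extr (S T U : finType) (h : S -> T -> U) (f : free_mod S) :
  linear (fun g => bilinear_ext h f g).
Proof.
move=> a u v; rewrite /bilinear_ext scaler_sumr -big_split /=.
apply: eq_bigr => s _; rewrite scaler_sumr -big_split /=.
apply: eq_bigr => t _.
by rewrite free_modD free_modZ scalerA -scalerDl mulrDr mulrCA.
Qed.

Lemma bilinear_ext_delta (S T U : finType) (h : S -> T -> U) s t :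
  bilinear_ext h (delta s) (delta t) = delta (h s t).
Proof.
rewrite /bilinear_ext (bigD1 s) //= [X in _ + X]big1 => [|s' hs].
  rewrite addr0 (bigD1 t) //= big1 => [|t' ht].
    by rewrite !deltaE !eqxx mulr1 scale1r addr0.
  by rewrite !deltaE (negbTE ht) mulr0 scale0r.
by rewrite big1 // => t' _; rewrite !deltaE (negbTE hs) mul0r scale0r.
Qed.

End FreeModule.

Section NCOperad.

Variables (K : fieldType) (M : finUMagma).

Definition NC_space n : lmodType K := free_mod K (nc_clique M n).

Definition nc_basis n (p : nc_clique M n) : NC_space n := delta K p.

Definition NC_pcomp n m (i : 'I_n) :
    NC_space n -> NC_space m -> NC_space (n + m).-1 :=
  bilinear_ext (@comp_nc M n m i).

Lemma NC_lin_ext n (V : lmodType K) (f g : NC_space n -> V) :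
  linear f -> linear g -> (forall p, f (nc_basis p) = g (nc_basis p)) ->
  f =1 g.
Proof. exact: linear_ext. Qed.

Lemma NC_pcomp_linearl n m (i : 'I_n) (g : NC_space m) :
  linear (fun f => NC_pcomp i f g).
Proof. exact: bilinear_extl. Qed.

Lemma NC_pcomp_linearr n m (i : 'I_n) (f : NC_space n) :
  linear (fun g : NC_space m => NC_pcomp i f g).
Proof. exact: bilinear_extr. Qed.

Lemma NC_pcomp_basis n m (i : 'I_n) (p : nc_clique M n) (q : nc_clique M m) :
  NC_pcomp i (nc_basis p) (nc_basis q) = nc_basis (comp_nc i p q).
Proof. exact: bilinear_ext_delta. Qed.

Lemma NC_cast_linear n m (e : n = m) :
  linear (fun x : NC_space n => ecast k (NC_space k) e x).
Proof. by case: m / e. Qed.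

Lemma NC_cast_basis n m (e : n = m) (p : nc_clique M n) :
  ecast k (NC_space k) e (nc_basis p) = nc_basis (ecast k (nc_clique M k) e p).
Proof. by case: m / e. Qed.

Lemma NC_space0 (x : NC_space 0) : x = 0.
Proof. by apply/ffunP => p; have := nc_gt0 p. Qed.

Lemma NC_pcomp_unitl n (x : NC_space n) :
  NC_pcomp ord0 (nc_basis (unit_nc M)) x = x :> NC_space n.
Proof.
move: x; apply: (@NC_lin_ext n (NC_space n)) => [||p].
- exact: (@NC_pcomp_linearr 1 n ord0).
- by [].
- by rewrite (@NC_pcomp_basis 1 n) -[RHS](congr1 (@nc_basis n) (comp_nc_unitl p)).
Qed.

Lemma NC_pcomp_unitr n (i : 'I_n) (x : NC_space n) (e : (n + 1).-1 = n) :
  ecast k (NC_space k) e (NC_pcomp i x (nc_basis (unit_nc M))) = x.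
Proof.
move: x; apply: NC_lin_ext => [||p].
- exact: linear_comp (NC_cast_linear e) (NC_pcomp_linearl i _).
- by [].
- by rewrite NC_pcomp_basis NC_cast_basis comp_nc_unitr.
Qed.

Lemma NC_pcomp_seq n m l (i : 'I_n) (j : 'I_m) (k : 'I_(n + m).-1)
    (x : NC_space n) (y : NC_space m) (z : NC_space l)
    (e : ((n + m).-1 + l).-1 = (n + (m + l).-1).-1) :
  k = (i + j)%N :> nat ->
  ecast a (NC_space a) e (NC_pcomp k (NC_pcomp i x y) z) =
    NC_pcomp i x (NC_pcomp j y z).
Proof.
move=> kE; move: x; apply: NC_lin_ext => [||p].
- exact: linear_comp (NC_cast_linear e)
    (linear_comp (NC_pcomp_linearl k z) (NC_pcomp_linearl i y)).
- exact: NC_pcomp_linearl.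
move: y; apply: NC_lin_ext => [||q].
- exact: linear_comp (NC_cast_linear e)
    (linear_comp (NC_pcomp_linearl k z) (NC_pcomp_linearr i _)).
- exact: linear_comp (NC_pcomp_linearr i _) (NC_pcomp_linearl j z).
move: z; apply: NC_lin_ext => [||r].
- exact: linear_comp (NC_cast_linear e) (NC_pcomp_linearr k _).
- exact: linear_comp (NC_pcomp_linearr i _) (NC_pcomp_linearr j _).
by rewrite !NC_pcomp_basis NC_cast_basis (comp_nc_seq p q r e kE).
Qed.

Lemma NC_pcomp_par n m l (i j : 'I_n) (k : 'I_(n + m).-1)
    (i' : 'I_(n + l).-1)
    (x : NC_space n) (y : NC_space m) (z : NC_space l)
    (e : ((n + m).-1 + l).-1 = ((n + l).-1 + m).-1) :
  (i < j)%N -> k = (j + m).-1 :> nat -> i' = i :> nat ->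
  ecast a (NC_space a) e (NC_pcomp k (NC_pcomp i x y) z) =
    NC_pcomp i' (NC_pcomp j x z) y.
Proof.
move=> ij kE iE; move: x; apply: NC_lin_ext => [||p].
- exact: linear_comp (NC_cast_linear e)
    (linear_comp (NC_pcomp_linearl k z) (NC_pcomp_linearl i y)).
- exact: linear_comp (NC_pcomp_linearl i' y) (NC_pcomp_linearl j z).
move: y; apply: NC_lin_ext => [||q].
- exact: linear_comp (NC_cast_linear e)
    (linear_comp (NC_pcomp_linearl k z) (NC_pcomp_linearr i _)).
- exact: NC_pcomp_linearr.
move: z; apply: NC_lin_ext => [||r].
- exact: linear_comp (NC_cast_linear e) (NC_pcomp_linearr k _).
- exact: linear_comp (NC_pcomp_linearl i' _) (NC_pcomp_linearr j _).
by rewrite !NC_pcomp_basis NC_cast_basis (comp_nc_par p q r e ij kE iE).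
Qed.

Definition NC : ns_operad K :=
  {| component := NC_space;
     pcomp := NC_pcomp;
     opunit := nc_basis (unit_nc M);
     component0 := NC_space0;
     pcomp_linearl := NC_pcomp_linearl;
     pcomp_linearr := NC_pcomp_linearr;
     pcomp_unitl := NC_pcomp_unitl;
     pcomp_unitr := NC_pcomp_unitr;
     pcomp_seq := NC_pcomp_seq;
     pcomp_par := NC_pcomp_par |}.

Definition triangle_op (p : clique M 2) : NC 2%N := nc_basis (triangle_nc p).

End NCOperad.

Definition magma_compatible (K : fieldType) (M : finUMagma) (A : lmodType K)
    (omega : M -> {linear A -> A}) : Prop :=
  (forall a, omega one a = a) /\
  (forall x y a, omega x (omega y a) = omega (star x y) a).

(* Main.v *)
Require Import Defs.
From mathcomp Require Import all_boot all_algebra.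
From mathcomp Require Import zify.

Set Implicit Arguments.
Unset Strict Implicit.
Unset Printing Implicit Defensive.

Import GRing.Theory.
Local Open Scope ring_scope.

(** Reading a noncrossing clique p of arity n as a dissected polygon, the word
    a_0 ... a_(n-1) can be evaluated along it.  An arc (x, y) carries the
    image under omega_(p(x, y)) of the letter a_x if it is an edge, and otherwise
    of the product of the values carried by two arcs (x, z) and (z, y) that form with
    it a triangle of some triangulation containing the solid diagonals.  The
    action of p is the value carried by the base.

    The choice of the triangulation is irrelevant: two triangulations that
    contain the solid diagonals differ by flips of diagonals labelled by the
    unit.  As omega_1 is the identity, such a flip is an instance of the
    associativity of odot ([arc_input_split]).  Since the cliques are
    noncrossing, a vertex that no solid arc passes over always exists
    ([uncrossed_apex]).

    The operad axiom follows.  A triangulation of p o_i q can be chosen that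
    contains the arc (i, i + m) along which p and q are glued.  Below this arc
    the evaluation is that of q ([arc_input_inner]), outside of it that of p
    ([arc_value_outer]), and on the arc itself the label p_i * q_0 acts as
    omega_(p_i) after omega_(q_0) by compatibility.  Multilinearity holds
    because each letter is used exactly once. *)

(** * Vertices that no solid arc passes over *)

Section Uncrossed.

Variables (M : finUMagma) (L : nat -> nat -> M).

Definition noncrossing_labels (n : nat) : Prop :=
  forall x x' y y', (x < x')%N -> (x' < y)%N -> (y < y')%N -> (y' <= n)%N ->
    L x y = Defs.one \/ L x' y' = Defs.one.

(** The arc (x, y) itself passes over z and may be solid. *)
Definition uncrossed (x y z : nat) : Prop :=
  (x < z < y)%N /\
  forall u v, (x <= u)%N -> (u < z)%N -> (z < v)%N -> (v <= y)%N ->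
    (x < u)%N || (v < y)%N -> L u v = Defs.one.

(** The last solid neighbour of x below y, a concrete choice of the third vertex
    of a triangle with side (x, y); without such a neighbour, x + 1 will do. *)
Fixpoint apex (x y : nat) : nat :=
  if y is y'.+1 then
    if (x < y')%N && (L x y' != Defs.one) then y' else apex x y'
  else x.+1.

Lemma apex_gt x y : (x < apex x y)%N.
Proof. by elim: y => //= y IH; case: ifP => // /andP[]. Qed.

Lemma apex_lt x y : (x.+1 < y)%N -> (apex x y < y)%N.
Proof.
move=> h; have : (apex x y <= maxn x.+1 y.-1)%N.
  by elim: y {h} => //= y; case: ifP => _; lia.
lia.
Qed.

Lemma apex_solid x y : apex x y = x.+1 \/ L x (apex x y) <> Defs.one.
Proof. by elim: y => [|y IH] /=; [left|case: ifP => // /andP[_ /eqP]; right]. Qed.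

Lemma apex_last x y v : (apex x y < v)%N && (v < y)%N -> L x v = Defs.one.
Proof.
elim: y => [|y IH] /=; first by lia.
case: ifP => [|h hv]; first by lia.
have [vy|vy] := eqVneq v y; last by apply: IH; lia.
have xv : (x < y)%N by have := apex_gt x y; lia.
by move: h; rewrite vy xv /=; case: eqP.
Qed.

(** A solid arc over the last solid neighbour z of x would start after x, and
    thus cross (x, z). *)
Lemma uncrossed_apex n x y :
  noncrossing_labels n ->
  (x.+1 < y)%N -> (y <= n)%N -> uncrossed x y (apex x y).
Proof.
move=> nc xy yn; have h1 := apex_gt x y; have h2 := apex_lt xy.
split=> [|u v xu uz zv vy ne]; first by rewrite h1.
have [ux|ux] := eqVneq u x.
  by rewrite ux; apply: (@apex_last x y); lia.
case: (apex_solid x y) => [?|sz]; first by lia.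
by case: (nc x u (apex x y) v) => //; lia.
Qed.

End Uncrossed.

(** * Evaluation of a word along a clique *)

Section Evaluation.

Variables (K : fieldType) (M : finUMagma) (A : lmodType K).
Variable odot : {bilinear A -> A -> A}.
Variable omega : M -> {linear A -> A}.

(** The product carried by the arc (x, y) before its own label is applied.  The
    depth k of the recursion only has to reach y - x, and the default value 0
    is then never used ([arc_input_recE]). *)
Fixpoint arc_input_rec (L : nat -> nat -> M) (a : nat -> A) (k x y : nat) : A :=
  if k is k'.+1 then
    if y == x.+1 then a x
    else odot (omega (L x (apex L x y)) (arc_input_rec L a k' x (apex L x y)))
              (omega (L (apex L x y) y) (arc_input_rec L a k' (apex L x y) y))
  else 0.

Definition arc_input L a x y : A := arc_input_rec L a (y - x) x y.
Definition arc_value L a x y : A := omega (L x y) (arc_input L a x y).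

Lemma arc_input_recE L a k x y : (x < y)%N -> (y - x <= k)%N ->
  arc_input_rec L a k x y = arc_input L a x y.
Proof.
move=> xy hk; rewrite /arc_input.
have [d] := ubnP (y - x); elim: d k x y xy hk => // d IH [|k] x y xy hk hd.
  by lia.
case e: (y - x)%N hd => [|d'] hd; first by lia.
rewrite /=; case: eqP => // ne.
have h1 := apex_gt L x y; have h2 : (apex L x y < y)%N by apply: apex_lt; lia.
by congr (odot (omega _ _) (omega _ _)); rewrite [LHS]IH ?[RHS]IH //; lia.
Qed.

Lemma arc_input_edge L a x : arc_input L a x x.+1 = a x.
Proof. by rewrite /arc_input subSnn /= eqxx. Qed.

Lemma arc_input_apex L a x y : (x.+1 < y)%N ->
  arc_input L a x y =
    odot (arc_value L a x (apex L x y)) (arc_value L a (apex L x y) y).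
Proof.
move=> xy; have h1 := apex_gt L x y; have h2 := apex_lt L xy.
rewrite {1}/arc_input; case e: (y - x)%N => [|d] /=; first by lia.
case: eqP => [|_]; first by lia.
by rewrite !arc_input_recE //; lia.
Qed.

Lemma arc_input_local L a b x y : (x < y)%N ->
  (forall j, (x <= j < y)%N -> a j = b j) ->
  arc_input L a x y = arc_input L b x y.
Proof.
have [d] := ubnP (y - x); elim: d x y => // d IH x y hd xy ab.
have [->|ne] := eqVneq y x.+1; first by rewrite !arc_input_edge ab //; lia.
have xy1 : (x.+1 < y)%N by lia.
have h1 := apex_gt L x y; have h2 := apex_lt L xy1.
rewrite !arc_input_apex // /arc_value.
by congr (odot (omega _ _) (omega _ _)); apply: IH; try lia;
  move=> j hj; apply: ab; lia.
Qed.

Lemma arc_input_linear L a b c i s x y :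
  (x <= i < y)%N -> c i = s *: a i + b i ->
  (forall j, j != i -> c j = a j /\ c j = b j) ->
  arc_input L c x y = s *: arc_input L a x y + arc_input L b x y.
Proof.
have [d] := ubnP (y - x); elim: d x y => // d IH x y hd xiy ci cj.
have [yx|ne] := eqVneq y x.+1.
  rewrite yx !arc_input_edge; have -> : x = i by lia.
  by [].
have xy1 : (x.+1 < y)%N by lia.
have h1 := apex_gt L x y; have h2 := apex_lt L xy1.
rewrite !arc_input_apex // /arc_value.
(* The letter i lies on one side of the apex; the factor of the other side is
   the same for the three words. *)
have [iz|zi] := ltnP i (apex L x y).
  rewrite (IH x (apex L x y)) //; try lia.
  rewrite -(@arc_input_local L c a (apex L x y) y); try lia; last first.
    by move=> j hj; case: (cj j) => //; lia.
  rewrite -(@arc_input_local L c b (apex L x y) y); try lia; last first.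
    by move=> j hj; case: (cj j) => //; lia.
  by rewrite linearP linearPl.
rewrite (IH (apex L x y) y) //; try lia.
rewrite -(@arc_input_local L c a x (apex L x y)); try lia; last first.
  by move=> j hj; case: (cj j) => //; lia.
rewrite -(@arc_input_local L c b x (apex L x y)); try lia; last first.
  by move=> j hj; case: (cj j) => //; lia.
by rewrite linearP linearPr.
Qed.

Hypothesis odotA : associative odot.
Hypothesis omegaM : magma_compatible omega.

Lemma arc_value_plain L a x y : L x y = Defs.one ->
  arc_value L a x y = arc_input L a x y.
Proof. by rewrite /arc_value => ->; case: omegaM. Qed.

(** Any uncrossed vertex z may replace the apex z0.  As z and z0 are both
    uncrossed, the diagonals of the quadrilateral formed by x, y, z and z0 are
    not solid, and the two ways of triangulating it agree by
    associativity. *)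
Lemma arc_input_split n L a x y z :
  noncrossing_labels L n ->
  (y <= n)%N -> uncrossed L x y z ->
  arc_input L a x y = odot (arc_value L a x z) (arc_value L a z y).
Proof.
move=> nc; have [d] := ubnP (y - x); elim: d x y z => // d IH x y z hd yn [xzy hz].
have xy1 : (x.+1 < y)%N by lia.
have [xz0y hz0] := uncrossed_apex nc xy1 yn.
rewrite arc_input_apex //; move: (apex L x y) xz0y hz0 => z0 xz0y hz0.
have [zz0|z0z|-> //] := ltngtP z z0.
  rewrite (@arc_value_plain L a x z0); last by apply: hz; lia.
  rewrite (@arc_value_plain L a z y); last by apply: hz0; lia.
  rewrite (IH x z0 z) ?(IH z y z0) ?odotA //; try lia.
    by split=> [|u v *]; [lia|apply: hz0; lia].
  by split=> [|u v *]; [lia|apply: hz; lia].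
rewrite (@arc_value_plain L a z0 y); last by apply: hz; lia.
rewrite (@arc_value_plain L a x z); last by apply: hz0; lia.
rewrite (IH z0 y z) ?(IH x z z0) ?odotA //; try lia.
  by split=> [|u v *]; [lia|apply: hz0; lia].
by split=> [|u v *]; [lia|apply: hz; lia].
Qed.

(** * Evaluation along a composition *)

Section Composition.

Variables (n m : nat) (i : 'I_n) (p : nc_clique M n) (q : nc_clique M m).
Variable a : nat -> A.

Let r := comp_nc i p q.

Lemma nc_noncrossing k (s : nc_clique M k) :
  noncrossing_labels (nclabel s) k.
Proof. by have /noncrossingP := valP s. Qed.

(** Equality of inputs and not of values, so that it also holds on the gluing
    arc, the only one whose label is not that of q. *)
Lemma arc_input_inner b x y :
  (forall k, (k < m)%N -> b k = a (i + k)%N) -> (x < y)%N -> (y <= m)%N ->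
  arc_input (nclabel r) a (i + x) (i + y) = arc_input (nclabel q) b x y.
Proof.
move=> hb; have iN := ltn_ord i.
have rq u v : (u < v)%N -> (v <= m)%N -> (0 < u)%N || (v < m)%N ->
    nclabel r (i + u) (i + v) = nclabel q u v.
  move=> *; rewrite /r; case: nclabel_compP; try (move=> *; lia).
  by move=> *; congr nclabel; lia.
have [d] := ubnP (y - x); elim: d x y => // d IH x y hd xy ym.
have [->|ne] := eqVneq y x.+1; first by rewrite addnS !arc_input_edge hb //; lia.
have [|xzy hz] := uncrossed_apex (x := x) (nc_noncrossing q) _ ym.
  by lia.
rewrite (@arc_input_apex (nclabel q) b); last by lia.
move: (apex _ x y) xzy hz => z xzy hz.
rewrite (@arc_input_split _ _ _ _ _ (i + z)%N (nc_noncrossing r)); last 1 first.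
- split=> [|u v *]; first by lia.
  have -> : u = (i + (u - i))%N by lia.
  have -> : v = (i + (v - i))%N by lia.
  by rewrite rq; [apply: hz|..]; lia.
- by rewrite /arc_value !rq ?IH //; lia.
- by lia.
Qed.

(** The vertex of the composition that corresponds to the vertex x of p. *)
Definition outer_vertex (x : nat) : nat :=
  if (x <= i)%N then x else (x + m).-1.

(** The recursion on p stops at its edges, where the word b of p differs from a
    only at the gluing arc: there the letter is the value of q, and the label
    p_i * q_0 of the composition is split by compatibility. *)
Lemma arc_value_outer b x y :
  (forall k, (k < n)%N -> b k =
     if (k < i)%N then a k
     else if (i < k)%N then a (k + m).-1
     else arc_value (nclabel q) (fun k => a (i + k)%N) 0 m) ->
  (x < y)%N -> (y <= n)%N ->
  arc_value (nclabel r) a (outer_vertex x) (outer_vertex y) =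
    arc_value (nclabel p) b x y.
Proof.
move=> hb; have iN := ltn_ord i; have m0 := nc_gt0 q.
have rp u v : (u < v)%N -> (v <= n)%N -> (u != i :> nat) || (v != i.+1) ->
    nclabel r (outer_vertex u) (outer_vertex v) = nclabel p u v.
  move=> *; rewrite /r /outer_vertex; case: nclabel_compP; repeat case: ifP;
    by move=> *; try (by congr nclabel; lia); exfalso; lia.
have [d] := ubnP (y - x); elim: d x y => // d IH x y hd xy yn.
have [ey|ne] := eqVneq y x.+1.
  have [xi|xi] := eqVneq x i.
    rewrite {}ey {}xi /arc_value arc_input_edge hb // !ltnn /arc_value.
    have -> : outer_vertex i = (i + 0)%N by rewrite /outer_vertex leqnn addn0.
    have -> : outer_vertex i.+1 = (i + m)%N by rewrite /outer_vertex ltnn addSn.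
    rewrite (@arc_input_inner (fun k => a (i + k)%N)) //.
    have -> : nclabel r (i + 0) (i + m) =
              star (nclabel p i i.+1) (nclabel q 0 m).
      rewrite /r; case: nclabel_compP => //; lia.
    by case: omegaM.
  rewrite /arc_value rp ?xi //; congr (omega _ _); rewrite {}ey in yn *.
  rewrite arc_input_edge hb // /outer_vertex.
  have [xlt|xge] := ltnP x i; first by rewrite ltnW // arc_input_edge.
  have -> : (x <= i)%N = false by lia.
  have -> : (i < x)%N by lia.
  have -> : (x.+1 + m).-1 = (x + m).-1.+1 by lia.
  by rewrite arc_input_edge.
have [|xzy hz] := uncrossed_apex (x := x) (nc_noncrossing p) _ yn.
  by lia.
rewrite /arc_value rp //; last by lia.
congr (omega _ _).
rewrite (@arc_input_apex (nclabel p) b); last by lia.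
move: (apex _ x y) xzy hz => z xzy hz.
rewrite (@arc_input_split _ _ _ _ _ (outer_vertex z) (nc_noncrossing r)); last 1 first.
- split=> [|u v]; first by rewrite /outer_vertex; do !case: ifP; lia.
  (* The image of z is not strictly below the gluing arc.  Hence an arc over it
     with an end strictly below the gluing arc crosses the latter, and has a
     unit label; the other arcs come from p. *)
  rewrite /r /outer_vertex; case: nclabel_compP => //; do !case: ifP => ?;
    by move=> *; try lia; apply: hz; lia.
- by rewrite !IH //; lia.
- by rewrite /outer_vertex; do !case: ifP; lia.
Qed.

End Composition.

(** * The action of the operad *)

(** The default 0 of [nth] is never read: only the letters 0 to n - 1 are. *)
Definition nc_eval n (p : nc_clique M n) (a : n.-tuple A) : A :=
  arc_value (nclabel p) (nth 0 a) 0 n.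

Definition nc_act n (f : NC K M n) (a : n.-tuple A) : A :=
  \sum_p (f : NC_space K M n) p *: nc_eval p a.

Lemma nc_act_basis n (p : nc_clique M n) a :
  nc_act (nc_basis K p) a = nc_eval p a.
Proof.
rewrite /nc_act (bigD1 p) //= big1 => [|s sp].
  by rewrite deltaE eqxx scale1r addr0.
by rewrite deltaE (negbTE sp) scale0r.
Qed.

Lemma nc_act_linear n a : linear (fun f : NC K M n => nc_act f a).
Proof.
move=> s f g; rewrite /nc_act scaler_sumr -big_split /=.
apply: eq_bigr => p _.
by rewrite free_modD free_modZ scalerA scalerDl.
Qed.

Lemma nth_set_input n (a : n.-tuple A) (i : 'I_n) v j :
  nth 0 (set_input a i v) j = if j == i then v else nth 0 a j.
Proof.
have [jn|jn] := ltnP j n.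
  rewrite -[j]/(val (Ordinal jn)) -[LHS](tnth_nth _ (set_input a i v)) tnth_mktuple.
  by rewrite (tnth_nth 0) (inj_eq val_inj).
by rewrite !nth_default ?size_tuple //; case: eqP => // e; have := ltn_ord i; lia.
Qed.

Lemma nc_eval_multilinear n p (a : n.-tuple A) i :
  linear (fun v => nc_eval p (set_input a i v)).
Proof.
move=> s u v; rewrite /nc_eval /arc_value -linearP; congr (omega _ _).
apply: (@arc_input_linear _ _ _ _ i); rewrite ?ltn_ord ?nth_set_input ?eqxx //.
by move=> j ji; rewrite !nth_set_input (negbTE ji).
Qed.

Lemma nc_act_multilinear n f (a : n.-tuple A) i :
  linear (fun v => nc_act f (set_input a i v)).
Proof.
move=> s u v; rewrite /nc_act scaler_sumr -big_split /=.
apply: eq_bigr => p _.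
by rewrite nc_eval_multilinear scalerDr !scalerA mulrC.
Qed.

(** Makes the action linear in the contracted input. *)
Lemma contract_set_input n m (i : 'I_n) v (a : (n + m).-1.-tuple A) :
  contract i v a = set_input (contract i 0 a) i v.
Proof.
apply: eq_from_tnth => j; rewrite !tnth_mktuple -val_eqE /=.
by case: (ltngtP j i).
Qed.

Lemma nc_eval_comp n m (i : 'I_n) (p : nc_clique M n) (q : nc_clique M m)
    (a : (n + m).-1.-tuple A) :
  nc_eval (comp_nc i p q) a =
    nc_eval p (contract i (nc_eval q (block i a)) a).
Proof.
have iN := ltn_ord i; have n0 := nc_gt0 p; have m0 := nc_gt0 q.
rewrite /nc_eval -(@arc_value_outer n m i p q (nth 0 a)) //.
  have -> : outer_vertex m i n = (n + m).-1 by rewrite /outer_vertex leqNgt iN.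
  by [].
move=> k kn.
rewrite -[k]/(val (Ordinal kn)) -[LHS](tnth_nth _ (contract _ _ _)).
rewrite tnth_mktuple /=; case: ifP => // _; case: ifP => // _.
rewrite /arc_value; congr (omega _ _); apply: arc_input_local => // j /= jm.
by rewrite -[j]/(val (Ordinal jm)) -[LHS](tnth_nth _ (block i a)) tnth_mktuple.
Qed.

Lemma nc_act_pcomp n m (i : 'I_n) (f : NC K M n) (g : NC K M m)
    (a : (n + m).-1.-tuple A) :
  nc_act (Defs.pcomp i f g) a =
    nc_act f (contract i (nc_act g (block i a)) a).
Proof.
have contract_linear h : linear (fun v => nc_act h (contract i v a)).
  by move=> s u v; rewrite contract_set_input nc_act_multilinear -!contract_set_input.
move: f; apply: NC_lin_ext => [||p].
- exact: linear_comp (nc_act_linear a) (NC_pcomp_linearl i g).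
- exact: nc_act_linear.
move: g; apply: NC_lin_ext => [||q].
- exact: linear_comp (nc_act_linear a) (NC_pcomp_linearr i _).
- exact: linear_comp (contract_linear (nc_basis K p)) (nc_act_linear (block i a)).
by rewrite [Defs.pcomp _ _ _]NC_pcomp_basis !nc_act_basis nc_eval_comp.
Qed.

Lemma nc_act_unit a : nc_act opunit [tuple a] = a.
Proof.
rewrite [LHS]nc_act_basis /nc_eval arc_value_plain ?arc_input_edge //.
exact: nclabel1.
Qed.

Lemma nc_act_triangle (p : clique M 2) a1 a2 :
  nc_act (triangle_op K p) [tuple a1; a2] =
    omega (base (val p))
      (odot (omega (edge (val p) 0) a1) (omega (edge (val p) 1) a2)).
Proof.
rewrite [LHS]nc_act_basis /nc_eval /arc_value arc_input_apex //.
have -> : apex (nclabel (triangle_nc p)) 0 2 = 1%N.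
  by have := apex_gt (nclabel (triangle_nc p)) 0 2;
     have := @apex_lt _ (nclabel (triangle_nc p)) 0 2 isT; lia.
by rewrite /arc_value !arc_input_edge.
Qed.

End Evaluation.

Theorem theorem4p4p1 (K : fieldType) (charK : [pchar K] =i pred0)
    (M : finUMagma) (A : lmodType K)
    (odot : {bilinear A -> A -> A}) (odotA : associative odot)
    (omega : M -> {linear A -> A}) (omegaM : magma_compatible omega) :
  exists act : forall n : nat, NC K M n -> n.-tuple A -> A,
    is_operad_algebra act /\
    forall (p : clique M 2) (a1 a2 : A),
      act 2%N (triangle_op K p) [tuple a1; a2] =
        omega (base (val p))
          (odot (omega (edge (val p) 0) a1) (omega (edge (val p) 1) a2)).
Proof.
exists (@nc_act K M A odot omega); split; last exact: nc_act_triangle.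
split.
- exact: nc_act_linear.
- exact: nc_act_multilinear.
- exact: nc_act_unit.
- exact: nc_act_pcomp.
Qed.
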